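(* Let $\mathbf{L}=\langle L,\wedge,\vee,\otimes,\rightarrow,0,1\rangle$ be a complete residuated lattice. Let $\mathcal{D}_1$ and $\mathcal{D}'_1$ be ranked data tables on a relation scheme $R$ and let $\mathcal{D}_2$ and $\mathcal{D}'_2$ be ranked data tables on a relation scheme $T$ such that $R\cap T=\emptyset$. Then $$S(\mathcal{D}_1,\mathcal{D}'_1)\otimes S(\mathcal{D}_2,\mathcal{D}'_2)\leq S(\mathcal{D}_1\bowtie_{p\approx q}\mathcal{D}_2,\ \mathcal{D}'_1\bowtie_{p\approx q}\mathcal{D}'_2)$$ for any $p\in R$ and $q\in T$ having the same domain with similarity.
   Context: A complete residuated lattice $\mathbf{L}=\langle L,\wedge,\vee,\otimes,\rightarrow,0,1\rangle$ is a complete lattice with least element $0$ and greatest element $1$ such that $\langle L,\otimes,1\rangle$ is a commutative monoid and, for all $a,b,c\in L$, $a\otimes b\leq c$ if and only if $a\leq b\rightarrow c$. $Y$ is a set of attributes; a relation scheme is any subset $T\subseteq Y$. Each $y\in Y$ has a domain $D_y$ (a set) equipped with a similarity $\approx_y\colon D_y\times D_y\to L$, i.e., $u\approx_y u=1$ and $u\approx_y v=v\approx_y u$ for all $u,v\in D_y$; the pair $\langle D_y,\approx_y\rangle$ is called a domain with similarity. Attributes $p,q$ have the same domain with similarity if $D_p=D_q$ and $\approx_p$ equals $\approx_q$. Put $\mathrm{Tupl}(T)=\prod_{y\in T}D_y$; its elements $t$ (maps with $t(y)\in D_y$ for $y\in T$) are tuples over $T$. A ranked data table (RDT) on $T$ is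 a (finite) $\mathbf{L}$-set in $\mathrm{Tupl}(T)$, i.e., a map $\mathcal{D}\colon\mathrm{Tupl}(T)\to L$ (finite meaning that only finitely many tuples have nonzero value). For $R\cap T=\emptyset$, $r\in\mathrm{Tupl}(R)$, $t\in\mathrm{Tupl}(T)$, the concatenation $rt\in\mathrm{Tupl}(R\cup T)$ is given by $(rt)(y)=r(y)$ for $y\in R$ and $(rt)(y)=t(y)$ for $y\in T$. The Cartesian product of RDTs $\mathcal{D}_1$ on $R$ and $\mathcal{D}_2$ on $T$ is the RDT on $R\cup T$ given by $(\mathcal{D}_1\times\mathcal{D}_2)(rt)=\mathcal{D}_1(r)\otimes\mathcal{D}_2(t)$. For an RDT $\mathcal{D}$ on a scheme containing attributes $p,q$ with the same domain with similarity, $(\sigma_{p\approx q}(\mathcal{D}))(t)=\mathcal{D}(t)\otimes(t(p)\approx_p t(q))$. The similarity-based join is $\mathcal{D}_1\bowtie_{p\approx q}\mathcal{D}_2=\sigma_{p\approx q}(\mathcal{D}_1\times\mathcal{D}_2)$. For RDTs $\mathcal{D},\mathcal{D}'$ on the same scheme $T$, the subsethood degree is $S(\mathcal{D},\mathcal{D}')=\bigwedge_{t\in\mathrm{Tupl}(T)}\bigl(\mathcal{D}(t)\rightarrow\mathcal{D}'(t)\bigr)\in L$. *)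

(* Defs.v *)
From HB Require Import structures.
From mathcomp Require Import all_boot all_order.
From mathcomp Require Import boolp classical_sets functions cardinality.

Set Implicit Arguments.
Unset Strict Implicit.
Unset Printing Implicit Defensive.

Import Order.TTheory.

Declare Scope residuated_scope.
Delimit Scope residuated_scope with RL.
Local Open Scope classical_set_scope.
Local Open Scope order_scope.

(* [Order.TBLattice] provides the lattice operations and the bounds
   0 = \bot, 1 = \top; the case \bot = \top is not excluded. *)
HB.mixin Record isCompleteResiduated (d : Order.disp_t) L
    of Order.TBLattice d L := {
  rmul : L -> L -> L;
  rimp : L -> L -> L;
  ex_infimum : forall A : set L, infimums A !=set0;
  ex_supremum : forall A : set L, supremums A !=set0;
  rmulA : associative rmul;
  rmulC : commutative rmul;
  rmul1 : left_id \top rmul;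
  adjointness : forall a b c : L, (rmul a b <= c) = (a <= rimp b c)
}.

#[short(type="completeResiduatedLatticeType")]
HB.structure Definition CompleteResiduatedLattice (d : Order.disp_t) :=
  { L of isCompleteResiduated d L & Order.TBLattice d L }.

Notation "a ⊗ b" := (rmul a b) (at level 40, left associativity)
  : residuated_scope.
Notation "a ⇒ b" := (rimp a b) (at level 55, right associativity)
  : residuated_scope.
Local Open Scope residuated_scope.

Record simDomain (d : Order.disp_t) (L : completeResiduatedLatticeType d) :=
  SimDomain {
    carrier :> Type;
    sim : carrier -> carrier -> L;
    sim_refl : forall u, sim u u = \top;
    sim_sym : forall u v, sim u v = sim v u
  }.

Section RankedDataTables.
Variables (d : Order.disp_t) (L : completeResiduatedLatticeType d).
Variables (Y : Type) (Dom : Y -> simDomain L).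
Implicit Types R T : set Y.

(* Equality of the pairs carrier/similarity: the other two fields of
   [simDomain] are proofs, hence irrelevant (see [same_domainP]). *)
Definition same_domain (p q : Y) : Prop := Dom p = Dom q.

(* Transport of a value of the attribute q to the (equal) domain of p. *)
Definition dom_cast (p q : Y) (e : same_domain p q) (v : Dom q) : Dom p :=
  eq_rect_r (fun D : simDomain L => D) v e.

Lemma same_domainP (p q : Y) :
  same_domain p q <->
  exists e : carrier (Dom p) = carrier (Dom q),
    forall u v : Dom p,
      sim u v = sim (eq_rect _ id u _ e) (eq_rect _ id v _ e).
Proof.
rewrite /same_domain; split=> [->|]; first by exists erefl.
case: (Dom p) (Dom q) => [A s r c] [A' s' r' c'] /= [e].
case: _ / e s' r' c' => s' r' c' /= ss'.
have E : s = s' by apply/funext => u; apply/funext => v.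
by case: _ / E r' c' {ss'} => r' c'; congr SimDomain; exact: Prop_irrelevance.
Qed.

(* Elements of [set_type T] are attributes with a (boolean, hence irrelevant)
   proof of membership in T. *)
Definition Tupl T : Type := forall y : set_type T, Dom (\val y).

(* No finiteness is imposed; see [finite_rdt]. *)
Definition rdt T : Type := Tupl T -> L.

Definition finite_rdt T (D : rdt T) : Prop := finite_set [set t | D t != \bot].

Definition attr_inl R T (y : set_type R) : set_type (R `|` T) :=
  exist _ (\val y) (mem_set (or_introl (set_mem (valP y)))).

Definition attr_inr R T (y : set_type T) : set_type (R `|` T) :=
  exist _ (\val y) (mem_set (or_intror (set_mem (valP y)))).

Definition restrl R T (u : Tupl (R `|` T)) : Tupl R :=
  fun y => u (attr_inl T y).

Definition restrr R T (u : Tupl (R `|` T)) : Tupl T :=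
  fun y => u (attr_inr R y).

Lemma mem_setU_notl R T (y : Y) :
  y \in (R `|` T)%classic -> (y \in R) = false -> y \in T.
Proof. by rewrite in_setU => /orP[->|]. Qed.

(* The concatenation rt; meaningful for disjoint R and T. *)
Definition concat R T (r : Tupl R) (t : Tupl T) : Tupl (R `|` T) :=
  fun y =>
    match Sumbool.sumbool_of_bool (\val y \in R) with
    | left yR => r (exist _ (\val y) yR)
    | right yNR => t (exist _ (\val y) (mem_setU_notl (valP y) yNR))
    end.

(* Every tuple u over R `|` T is the concatenation of its restrictions
   ([concat_restr]), so that for disjoint R and T this is the table with
   (D1 x D2)(rt) = D1(r) ⊗ D2(t) ([cart_concat]). *)
Definition cart R T (D1 : rdt R) (D2 : rdt T) : rdt (R `|` T) :=
  fun u => D1 (restrl u) ⊗ D2 (restrr u).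

Definition select T (p q : set_type T) (e : same_domain (\val p) (\val q))
    (D : rdt T) : rdt T :=
  fun t => D t ⊗ sim (t p) (dom_cast e (t q)).

Definition join R T (p : set_type R) (q : set_type T)
    (e : same_domain (\val p) (\val q)) (D1 : rdt R) (D2 : rdt T) :
    rdt (R `|` T) :=
  @select (R `|` T) (attr_inl T p) (attr_inr R q) e (cart D1 D2).

(* [infimum x0 A] is x0 on the empty set, so the default must be \top. *)
Definition subsethood T (D D' : rdt T) : L :=
  infimum \top [set D t ⇒ D' t | t in [set: Tupl T]].

Lemma infimum_topP (A : set L) : infimums A (infimum \top A).
Proof.
rewrite /infimum; case: ifPn => [/eqP ->|_].
  by split=> // x _; exact: lex1.
by case: (ex_infimum A) => x Ax; exact: (xgetPex _ (ex_intro _ x Ax)).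
Qed.

Lemma tupl_irr T (t : Tupl T) (y : Y) (h h' : y \in T) :
  t (exist _ y h) = t (exist _ y h').
Proof. by rewrite (bool_irrelevance h h'). Qed.

Lemma concat_restr R T (u : Tupl (R `|` T)) :
  concat (restrl u) (restrr u) = u.
Proof.
apply: functional_extensionality_dep => -[y yRT]; rewrite /concat /=.
by case: Sumbool.sumbool_of_bool => ?; exact: (tupl_irr u).
Qed.

Lemma restrl_concat R T (r : Tupl R) (t : Tupl T) : restrl (concat r t) = r.
Proof.
apply: functional_extensionality_dep => -[y yR]; rewrite /restrl /concat /=.
case: Sumbool.sumbool_of_bool => [?|yNR]; first exact: (tupl_irr r).
by exfalso; move: yR yNR => /= ->.
Qed.

Lemma restrr_concat R T (r : Tupl R) (t : Tupl T) :
  (R `&` T)%classic = set0 -> restrr (concat r t) = t.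
Proof.
move=> RT0; apply: functional_extensionality_dep => -[y yT].
rewrite /restrr /concat /=.
case: Sumbool.sumbool_of_bool => [yR|?]; last exact: (tupl_irr t).
have : (R `&` T)%classic y by split; apply: set_mem.
by rewrite RT0.
Qed.

Lemma cart_concat R T (D1 : rdt R) (D2 : rdt T) (r : Tupl R) (t : Tupl T) :
  (R `&` T)%classic = set0 -> cart D1 D2 (concat r t) = D1 r ⊗ D2 t.
Proof. by move=> RT0; rewrite /cart restrl_concat restrr_concat. Qed.

Lemma rmul0 (a : L) : \bot ⊗ a = \bot.
Proof. by apply/eqP; rewrite -lex0 adjointness le0x. Qed.

Lemma finite_join R T (p : set_type R) (q : set_type T)
    (e : same_domain (\val p) (\val q)) (D1 : rdt R) (D2 : rdt T) :
  finite_rdt D1 -> finite_rdt D2 -> finite_rdt (join e D1 D2).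
Proof.
move=> fD1 fD2; apply: sub_finite_set (finite_image2 (@concat R T) fD1 fD2).
move=> u /=; rewrite /join /select /cart => u0.
exists (restrl u); first by apply: contra_neq u0 => ->; rewrite !rmul0.
exists (restrr u); last exact: concat_restr.
by apply: contra_neq u0 => ->; rewrite (rmulC _ \bot) !rmul0.
Qed.

End RankedDataTables.

(* Main.v *)
Require Import Defs.
From mathcomp Require Import all_boot all_order.
From mathcomp Require Import boolp classical_sets.

Local Open Scope classical_set_scope.
Local Open Scope order_scope.
Local Open Scope residuated_scope.

Import Order.TTheory.

(** By adjointness, [a <= subsethood D D'] holds exactly when [a ⊗ D t <= D' t] for every tuple [t]
    ([subsethood_rmul], [le_subsethood]). The claim thus becomes a pointwise inequality, which
    follows by regrouping the product ([rmulACA]) and monotonicity of [⊗] ([rmul_mono]). *)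

Lemma rmul_mono (d : Order.disp_t) (L : completeResiduatedLatticeType d)
    (a a' b b' : L) : a <= a' -> b <= b' -> a ⊗ b <= a' ⊗ b'.
Proof.
have monol (x x' y : L) : x <= x' -> x ⊗ y <= x' ⊗ y.
  (* The unit of the adjunction, [x' <= y ⇒ (x' ⊗ y)], extends [x <= x']. *)
  by move=> xx'; rewrite adjointness (le_trans xx')// -adjointness.
move=> aa' bb'; apply: le_trans (monol _ _ b aa') _.
by rewrite !(rmulC a'); exact: monol.
Qed.

Lemma rmulACA (d : Order.disp_t) (L : completeResiduatedLatticeType d) :
  interchange (@rmul d L) (@rmul d L).
Proof.
by move=> a b a' b'; rewrite -!rmulA (rmulA b) (rmulC b) -(rmulA a').
Qed.

(** Graded modus ponens: the infimum lies below each residuum [D t ⇒ D' t]. *)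
Lemma subsethood_rmul (d : Order.disp_t) (L : completeResiduatedLatticeType d)
    (Y : Type) (Dom : Y -> simDomain L) (T : set Y) (D D' : rdt Dom T)
    (t : Tupl Dom T) : subsethood D D' ⊗ D t <= D' t.
Proof.
rewrite adjointness.
by have [+ _] := infimum_topP [set D t ⇒ D' t | t in [set: Tupl Dom T]]; apply; exists t.
Qed.

(** The infimum is the greatest lower bound of the residua; if there are no tuples, it is the
    default [\top], which [infimum_topP] also covers. *)
Lemma le_subsethood (d : Order.disp_t) (L : completeResiduatedLatticeType d)
    (Y : Type) (Dom : Y -> simDomain L) (T : set Y) (D D' : rdt Dom T) (a : L) :
  (forall t, a ⊗ D t <= D' t) -> a <= subsethood D D'.
Proof.
move=> aD.
have [_] := infimum_topP [set D t ⇒ D' t | t in [set: Tupl Dom T]]; apply.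
by move=> _ [t _ <-]; rewrite -adjointness.
Qed.

Theorem corollary2 (d : Order.disp_t) (L : completeResiduatedLatticeType d)
    (Y : Type) (Dom : Y -> simDomain L) (R T : set Y)
    (D1 D1' : rdt Dom R) (D2 D2' : rdt Dom T)
    (disjRT : (R `&` T)%classic = set0)
    (p : set_type R) (q : set_type T)
    (e : same_domain Dom (\val p) (\val q)) :
  subsethood D1 D1' ⊗ subsethood D2 D2'
    <= subsethood (join e D1 D2) (join e D1' D2').
Proof.
(* Each subsethood degree is paired with its own table, and the similarity factor, equal on both
   sides, is split off. *)
apply: le_subsethood => u; rewrite /join /select /cart rmulA rmulACA.
by do 2?apply: rmul_mono => //; exact: subsethood_rmul.
Qed.
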